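(* For any integer $k \ge 0$, the piecewise polynomials in the $k$th degree falling factorial basis satisfy, for all $x \in [a,b]$, $$\frac{1}{k!}\prod_{\ell=j-k}^{j-1}(x-x_\ell)\cdot 1\{x>x_{j-1}\} = (S^k_n 1_{x_{j-1}})(x),\qquad j=k+2,\ldots,n,$$ where $S^k_n$ is the $k$th order discrete integral operator with respect to $x_1,\ldots,x_n$, and $1_t$ denotes the step function $1_t(x)=1\{x>t\}$ on $[a,b]$.
   Context: Design points: $a \le x_1<\cdots<x_n\le b$, and $x_{n+1}=b$ for notational convenience. Empty products equal 1. Discrete integration. All operators act on real functions $f$ on $[a,b]$. For $k\ge1$, the weight map $W^k_n$ is $(W^k_nf)(x)=f(x)\cdot(x-x_{i-k+1})/k$ if $x\in(x_i,x_{i+1}]$ with $i\ge k$, and $(W^k_nf)(x)=f(x)$ if $x\le x_k$. For $k\ge 1$, let $\overline{S}_{n-k+1}$ denote the simple cumulative sum operator over the $n-k+1$ points $x_k,\ldots,x_n$: $(\overline{S}_{n-k+1}f)(x)=\sum_{j=k}^i f(x_j)+f(x)$ if $x\in(x_i,x_{i+1}]$ with $i\ge k$, and $(\overline{S}_{n-k+1}f)(x)=f(x)$ if $x\le x_k$. The discrete integral operators are $S^0_n=\mathrm{Id}$ (identity), $S^1_n=\overline S_n\circ W^1_n$, and $S^k_n=S^{k-1}_n\circ\overline{S}_{n-k+1}\circ W^k_n$ for $k\ge2$. *)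

(* Defs.v *)
From mathcomp Require Import all_boot all_order all_algebra.
From mathcomp Require Import reals.

Set Implicit Arguments.
Unset Strict Implicit.
Unset Printing Implicit Defensive.

Import Order.TTheory GRing.Theory Num.Theory.
Local Open Scope ring_scope.

Section DiscreteIntegration.
Variables (R : realType) (b : R) (n : nat) (xs : n.-tuple R).

(* The points are numbered from 1; reading past the end of the tuple yields
   the default b, which is the convention x_{n+1} = b. Index 0 is meaningless
   and is never read for 1 <= k <= i. *)
Definition point (i : nat) : R := nth b xs i.-1.

(* The index k <= i <= n of the cell (x_i, x_{i+1}] containing x. For
   1 <= k <= n and x <= b it is None exactly when x <= x_k (cell_SomeP and
   cell_NoneP below). *)
Definition cell (k : nat) (x : R) : option 'I_n.+1 :=
  [pick i : 'I_n.+1 | (k <= i)%N && (point i < x <= point i.+1)].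

(* Functions on [a, b] are represented by functions on R: the values of the
   operators below on [a, b] only involve values of f on [a, b]. *)
Definition weight (k : nat) (f : R -> R) (x : R) : R :=
  if cell k x is Some i then f x * (x - point (i - k + 1)) / k%:R else f x.

(* Indexed by its first point: this is the cumulative sum operator over the
   n - k + 1 points x_k, ..., x_n. *)
Definition cumsum (k : nat) (f : R -> R) (x : R) : R :=
  if cell k x is Some i then \sum_(k <= j < i.+1) f (point j) + f x else f x.

(* S^0 = Id makes the recursion valid from k = 1 on. *)
Fixpoint discrete_integral (k : nat) (f : R -> R) : R -> R :=
  if k is k'.+1 then discrete_integral k' (cumsum k (weight k f)) else f.

Definition step (t x : R) : R := (t < x)%R%:R.

Lemma point_last : point n.+1 = b.
Proof. by rewrite /point /= nth_default ?size_tuple. Qed.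

Hypothesis incr : forall i, (0 < i < n)%N -> point i < point i.+1.
Hypothesis last_le : point n <= b.

Lemma point_mono i j : (0 < i <= j)%N -> (j <= n.+1)%N -> point i <= point j.
Proof.
case/andP=> i0 ij; elim: j ij => [|j IH]; first by rewrite leqn0 => /eqP ->.
rewrite leq_eqVlt => /predU1P[->//|]; rewrite ltnS => ij jn.
apply: le_trans (IH ij (ltnW jn)) _.
move: jn; rewrite ltnS leq_eqVlt => /predU1P[->|jn]; first by rewrite point_last.
by apply/ltW/incr; rewrite jn (leq_trans i0 ij).
Qed.

Lemma cell_SomeP k x (i : 'I_n.+1) : (0 < k)%N ->
  cell k x = Some i <-> (k <= i)%N /\ point i < x <= point i.+1.
Proof.
move=> k0; have aux (p q : 'I_n.+1) : point p < x <= point p.+1 ->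
    point q < x <= point q.+1 -> (q <= p)%N.
  move=> /andP[_ xp] /andP[qx _]; rewrite leqNgt; apply/negP => pq.
  have pq1 := @point_mono p.+1 q pq (ltnW (ltn_ord q)).
  by have := lt_le_trans qx (le_trans xp pq1); rewrite ltxx.
rewrite /cell; case: pickP => [i' /andP[ki' h']|none].
  split=> [[<-]//|[ki h]].
  by congr Some; apply/val_inj/eqP; rewrite /= eqn_leq !aux.
by split=> // -[ki h]; have := none i; rewrite ki h.
Qed.

Lemma cell_NoneP k x : (0 < k <= n)%N -> x <= b ->
  cell k x = None <-> x <= point k.
Proof.
move=> /andP[k0 kn] xb; rewrite /cell.
case: pickP => [i /andP[ki /andP[ix _]]|none].
  split=> // xk.
  have ki1 : point k <= point i.
    by apply: point_mono; [rewrite k0 | exact: ltnW].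
  by have := lt_le_trans ix (le_trans xk ki1); rewrite ltxx.
split=> // _; rewrite leNgt; apply/negP => kx.
have above m : (k <= m)%N -> (m <= n.+1)%N -> point m < x.
  elim: m => [|m IH]; first by rewrite leqn0 => /eqP <-.
  rewrite leq_eqVlt => /predU1P[<-//|]; rewrite ltnS => km mn.
  have := none (Ordinal mn); rewrite /= km (IH km (ltnW mn)) /=.
  by move/negbT; rewrite -ltNge.
have := above n.+1 (leqW kn) (leqnn _).
by rewrite point_last ltNge xb.
Qed.

End DiscreteIntegration.

(* Main.v *)
Require Import Defs.
From mathcomp Require Import all_boot all_order all_algebra.
From mathcomp Require Import reals.
From mathcomp Require Import ring.

Set Implicit Arguments.
Unset Strict Implicit.
Unset Printing Implicit Defensive.

Import Order.TTheory GRing.Theory Num.Theory.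
Local Open Scope ring_scope.

(** Discrete integration undoes discrete differentiation: the inverse of the
    integral of order [m] sends a function [f] to the function whose value at
    [x] in the cell (x_i, x_{i+1}] is [m!] times the divided difference of [f]
    at x_{i-m+1}, ..., x_i, x.  So it suffices to recognize the step function
    as the [k]-th such derivative of the falling factorial.

    Write [p = j - 1] and let [P] be the falling factorial polynomial, a
    multiple of the product of the 'X - x_l over the last [k] nodes
    x_{p-k+1}, ..., x_p.  Because [P] vanishes at these nodes, [P] times the
    step at x_p agrees with [P] at every point that enters a divided difference
    of order at most [k] taken at some x > x_p, while all divided differences
    taken at x <= x_p are zero.  Hence only divided differences of polynomials
    are needed, and these are quotients: the divided difference of [P] at nodes
    y_1, ..., y_m, x is the value at [x] of the quotient of [P] by
    ('X - y_1) ... ('X - y_m).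

    One level of integration then telescopes, thanks to the recursion of
    divided differences ([horner_nodal_recursion]); the boundary term at x_p
    vanishes because of the divisibility of [P] ([cumsum_weight_tail_deriv]).
    At order [k] the divisor is monic of the same degree as [P], so that the
    quotient is the leading coefficient of [P] ([divp_eqsize_monic]), and the
    derivative is a step ([tail_deriv_nodal]). *)

(** * Quotients by monic polynomials *)

Section MonicQuotients.
Variable R : fieldType.
Implicit Types P N : {poly R}.

Lemma divp_eqsize_monic m N P : N \is monic -> size N = m.+1 ->
  (size P <= m.+1)%N -> P %/ N = (P`_m)%:P.
Proof.
move=> Nm sN sP.
have lt : (size (P - P`_m *: N)%R < size N)%N.
  rewrite sN ltnS; apply/leq_sizeP => d md; rewrite coefB coefZ.
  move: md; rewrite leq_eqVlt => /predU1P[<-|md].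
    by have := monicP Nm; rewrite /lead_coef sN /= => ->; rewrite mulr1 subrr.
  rewrite [N`__]nth_default ?sN // nth_default ?(leq_trans sP) //.
  by rewrite mulr0 subrr.
have {1}-> : P = (P`_m)%:P * N + (P - P`_m *: N).
  by rewrite mul_polyC addrC subrK.
by rewrite divpD mulpK ?monic_neq0 // (divp_small lt) addr0.
Qed.

(** Up to a multiple of 'X - a, the quotient by [N] is a coefficient of the
    remainder by [N * ('X - a)], which depends on [N] only through that
    product and the degree. *)
Lemma divp_monic_split m N P a : N \is monic -> size N = m.+1 ->
  P %/ N = P %/ (N * ('X - a%:P)) * ('X - a%:P)
           + ((P %% (N * ('X - a%:P)))`_m)%:P.
Proof.
move=> Nm sN; have N0 := monic_neq0 Nm.
set M : {poly R} := N * _.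
have M0 : M != 0 by rewrite mulf_neq0 ?polyXsubC_eq0.
have sR : (size (P %% M)%R <= m.+1)%N.
  have := ltn_modp P M; rewrite M0 /M size_Mmonic ?polyXsubC_eq0 ?monicXsubC //.
  by rewrite sN size_XsubC addn2.
rewrite -(divp_eqsize_monic Nm sN sR) {1}(divp_eq P M) divpD; congr (_ + _).
by rewrite [X in X %/ N](_ : _ = P %/ M * ('X - a%:P) * N) ?mulpK // /M; ring.
Qed.

End MonicQuotients.

Section Points.
Variables (R : realType) (b : R) (n : nat) (xs : n.-tuple R).
Implicit Types (P : {poly R}) (f g : R -> R).

Local Notation pt := (point b xs).

(** * Divided differences of polynomials *)

(** The [m] nodes that end with the [i]-th point. *)
Definition nodal (m i : nat) : {poly R} :=
  \prod_(i.+1 - m <= l < i.+1) ('X - (pt l)%:P).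

Lemma nodal_monic m i : nodal m i \is monic.
Proof. exact: monic_prod_XsubC. Qed.

Lemma size_nodal m i : (m <= i.+1)%N -> size (nodal m i) = m.+1.
Proof.
by move=> mi; rewrite /nodal size_prod_XsubC size_iota subKn.
Qed.

Lemma nodal0 i : nodal 0 i = 1.
Proof. by rewrite /nodal subn0 big_geq. Qed.

Lemma nodalS_right m i : (m <= i.+1)%N ->
  nodal m.+1 i.+1 = nodal m i * ('X - (pt i.+1)%:P).
Proof. by move=> mi; rewrite /nodal subSS big_nat_recr ?leq_subr. Qed.

Lemma nodalS_left m i : (m <= i)%N ->
  nodal m.+1 i = nodal m i * ('X - (pt (i - m))%:P).
Proof.
move=> mi; rewrite /nodal subSS big_ltn ?ltnS ?leq_subr // mulrC.
by rewrite subSn.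
Qed.

(** The recursion of divided differences. The two quotients on the left drop
    different end nodes from [nodal m.+1 i.+1], so by [divp_monic_split] they
    differ from multiples of the removed factors by the same constant; the
    second multiple vanishes at the node where it is evaluated. *)
Lemma horner_nodal_recursion m i P x : (m <= i)%N ->
  (P %/ nodal m i.+1).[x] - (P %/ nodal m i).[pt i.+1]
  = (P %/ nodal m.+1 i.+1).[x] * (x - pt (i.+1 - m)).
Proof.
move=> mi; have mi1 := leqW mi.
rewrite (divp_monic_split P (pt (i.+1 - m)) (nodal_monic m i.+1)
           (size_nodal (leqW mi1))).
rewrite (divp_monic_split P (pt i.+1) (nodal_monic m i) (size_nodal mi1)).
rewrite -nodalS_right // -nodalS_left // !hornerE.
ring.
Qed.

(** * Locality of discrete integration *)

Hypothesis incr : forall i, (0 < i < n)%N -> pt i < pt i.+1.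
Hypothesis last_le : pt n <= b.

Lemma point_le_last l : (0 < l <= n.+1)%N -> pt l <= b.
Proof.
by move=> /andP[l0 ln]; rewrite -[leRHS](point_last b xs) point_mono ?l0 /=.
Qed.

Lemma eq_weight k f g : {in <= b, f =1 g} ->
  {in <= b, weight b xs k f =1 weight b xs k g}.
Proof. by move=> fg x xb; rewrite /weight fg. Qed.

Lemma eq_cumsum k f g : (0 < k)%N -> {in <= b, f =1 g} ->
  {in <= b, cumsum b xs k f =1 cumsum b xs k g}.
Proof.
move=> k0 fg x xb; rewrite /cumsum fg //; case: cell => // i; congr (_ + _).
apply: eq_big_nat => l /andP[kl li]; apply/fg/point_le_last.
by rewrite (leq_trans k0 kl) (ltnW (leq_trans li _)).
Qed.

(** Since all points are at most [b], values beyond [b] are never read, which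
    allows replacing the integrand by a function equal to it up to [b] only.
    The step is such an integrand: beyond [b] there is no cell, and the
    derivatives that it is compared with are 0. *)
Lemma eq_discrete_integral k f g : {in <= b, f =1 g} ->
  {in <= b, discrete_integral b xs k f =1 discrete_integral b xs k g}.
Proof.
elim: k f g => [|k IH] f g fg //=.
exact/IH/eq_cumsum/eq_weight.
Qed.

(** * Discrete derivatives of a polynomial tail *)

(** The [m]-th discrete derivative of the function equal to [P] right of the
    [p]-th point and to 0 elsewhere, when [P] has roots at the last [m] nodes
    up to that point: divided differences are written as quotients. *)
Definition tail_deriv (p m : nat) P (x : R) : R :=
  if cell b xs p x is Some i then m`!%:R * (P %/ nodal m i).[x] else 0.

Lemma weight_tail_deriv p m P x (i : 'I_n.+1) : (m < p)%N ->
  cell b xs p x = Some i ->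
  weight b xs m.+1 (tail_deriv p m.+1 P) x =
    m`!%:R * ((P %/ nodal m i).[x] - (P %/ nodal m i.-1).[pt i]).
Proof.
move=> mp cx.
have /(cell_SomeP incr last_le _ _ (leq_ltn_trans (leq0n m) mp)) [pi hx] := cx.
have mi := leq_trans mp pi.
have cm : cell b xs m.+1 x = Some i by apply/cell_SomeP.
have i0 : (0 < i)%N := leq_ltn_trans (leq0n m) mi.
have := @horner_nodal_recursion m i.-1 P x.
rewrite prednK // -ltnS prednK // => /(_ mi) ->.
rewrite /weight cm /tail_deriv cx factS natrM addn1 -subSn // subSS.
by field; rewrite addrC natr1 pnatr_eq0.
Qed.

Lemma weight_tail_deriv0 p m k P x : cell b xs p x = None ->
  weight b xs k (tail_deriv p m P) x = 0.
Proof.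
by move=> cx; rewrite /weight /tail_deriv cx; case: cell => // i; rewrite !mul0r.
Qed.

(** Summation telescopes along the points after the [p]-th; what is left over
    at the [p]-th point itself vanishes because the quotient of [P] there still
    contains the factor of that node. *)
Lemma cumsum_weight_tail_deriv p m P : (m < p <= n)%N ->
  nodal m.+1 p %| P ->
  {in <= b, cumsum b xs m.+1 (weight b xs m.+1 (tail_deriv p m.+1 P))
            =1 tail_deriv p m P}.
Proof.
move=> /andP[mp pn] dP x xb.
have p0 : (0 < p)%N := leq_ltn_trans (leq0n m) mp.
have p0n : (0 < p <= n)%N by rewrite p0.
set V := weight _ _ _ _.
have V0 y : y <= pt p -> V y = 0.
  move=> yp; apply: weight_tail_deriv0; apply/(cell_NoneP incr last_le) => //.
  by apply: le_trans yp (point_le_last _); rewrite p0 leqW.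
pose U l := m`!%:R * (P %/ nodal m l.-1).[pt l].
have Up : U p = 0.
  move: dP; rewrite /U -(prednK p0) nodalS_right /=; last first.
    by rewrite prednK // ltnW.
  case/dvdpP => Q ->.
  rewrite mulrA mulrAC.
  by rewrite mulpK ?monic_neq0 ?nodal_monic // hornerM hornerXsubC subrr !mulr0.
have VS l : (p <= l)%N -> (l < n)%N -> V (pt l.+1) = U l.+1 - U l.
  move=> pl ln.
  have cl : cell b xs p (pt l.+1) = Some (Ordinal (leqW ln)).
    apply/cell_SomeP => //; split => //=.
    by rewrite lexx andbT incr // (leq_trans p0 pl).
  by rewrite /V (weight_tail_deriv P mp cl) mulrBr.
rewrite /cumsum; case cx: (cell b xs p x) => [i|].
  have /(cell_SomeP incr last_le _ _ p0) [pi hx] := cx.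
  have cm : cell b xs m.+1 x = Some i.
    by apply/cell_SomeP => //; rewrite (leq_trans mp pi).
  rewrite cm (big_cat_nat (n := p.+1)) ?ltnS //=; last exact: ltnW.
  rewrite big_nat big1 ?add0r; last first.
    move=> l /andP[ml lp]; apply/V0/point_mono => //; last by rewrite leqW.
    by rewrite (leq_ltn_trans _ ml) //= -ltnS.
  rewrite big_add1 /= (telescope_sumr_eq U) //; last first.
    by move=> l /andP[pl li]; rewrite VS // (leq_trans li) // -ltnS.
  rewrite Up /V (weight_tail_deriv P mp cx) /tail_deriv cx /U.
  by ring.
have /(cell_NoneP incr last_le p0n xb) xp := cx.
rewrite /tail_deriv cx V0 //; case cm: cell => [i|//].
have /(cell_SomeP incr last_le _ _ (ltn0Sn m)) [mi /andP[ix _]] := cm.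
rewrite addr0 big_nat big1 // => l /andP[ml li]; apply: V0.
apply: (le_trans _ xp); apply: (le_trans _ (ltW ix)).
apply: (point_mono incr last_le); last exact/ltnW.
by rewrite (leq_ltn_trans (leq0n m)).
Qed.

Lemma discrete_integral_tail_deriv p m P : (m <= p <= n)%N ->
  nodal m p %| P ->
  {in <= b, discrete_integral b xs m (tail_deriv p m P) =1 tail_deriv p 0 P}.
Proof.
elim: m => [|m IH] // /andP[mp pn] dP x xb /=.
have mpn : (m < p <= n)%N by rewrite mp.
rewrite (eq_discrete_integral m (cumsum_weight_tail_deriv mpn dP)) //.
apply: IH => //; first by rewrite ltnW.
by apply: dvdp_trans dP; rewrite nodalS_left ?dvdp_mulr // ltnW.
Qed.

Lemma tail_deriv0 p P x : (0 < p <= n)%N -> x <= b ->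
  tail_deriv p 0 P x = P.[x] * step (pt p) x.
Proof.
move=> pn xb; rewrite /tail_deriv /step; case cx: cell => [i|].
  have /andP[p0 _] := pn.
  have /(cell_SomeP incr last_le _ _ p0) [pi /andP[ix _]] := cx.
  rewrite nodal0 divp1 mul1r (le_lt_trans _ ix) ?mulr1 //.
  by apply: point_mono; rewrite ?p0 // ltnW.
have /(cell_NoneP incr last_le pn xb) := cx.
by rewrite leNgt => /negbTE ->; rewrite mulr0.
Qed.

(** A divided difference of maximal order only sees the leading coefficient,
    whatever the cell. *)
Lemma tail_deriv_nodal p k x : (k <= p)%N -> (0 < p <= n)%N -> x <= b ->
  tail_deriv p k ((k`!%:R)^-1 *: nodal k p) x = step (pt p) x.
Proof.
move=> kp pn xb; rewrite -[RHS]mul1r -(hornerC 1 x) -tail_deriv0 //.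
rewrite /tail_deriv; case cx: cell => [i|//].
have /andP[p0 _] := pn.
have /(cell_SomeP incr last_le _ _ p0) [pi _] := cx.
have kp1 := leqW kp.
have ki : (k <= i.+1)%N by rewrite leqW // (leq_trans kp).
have sP : (size (nodal k p) <= k.+1)%N by rewrite size_nodal.
rewrite divpZl (divp_eqsize_monic (nodal_monic k i) (size_nodal ki) sP).
have := monicP (nodal_monic k p); rewrite /lead_coef size_nodal //= => ->.
rewrite nodal0 divp1 hornerZ !hornerC mulrA mulfV ?mulr1 ?mul1r //.
by rewrite pnatr_eq0 -lt0n fact_gt0.
Qed.

End Points.

Theorem theorem2 (R : realType) (a b : R) (n : nat) (xs : n.-tuple R)
    (first_ge : a <= point b xs 1)
    (incr : forall i : nat, (0 < i < n)%N -> point b xs i < point b xs i.+1)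
    (last_le : point b xs n <= b)
    (k j : nat) (hj : (k + 2 <= j <= n)%N) (x : R) (hx : x \in `[a, b]) :
  (k`!%:R)^-1 * \prod_(j - k <= l < j) (x - point b xs l)
      * (point b xs (j - 1) < x)%R%:R
  = discrete_integral b xs k (step (point b xs (j - 1))) x.
Proof.
have xb : x <= b by move: hx; rewrite in_itv => /andP[].
case: j hj => [|p]; first by rewrite addn2.
rewrite addn2 ltnS subn1 /= => /andP[kp pn].
have pn' : (0 < p <= n)%N by rewrite (leq_ltn_trans (leq0n k) kp) ltnW.
pose P := (k`!%:R)^-1 *: nodal b xs k p.
have eP : {in <= b, step (point b xs p) =1 tail_deriv b xs p k P}.
  by move=> y yb; rewrite tail_deriv_nodal // ltnW.
rewrite (eq_discrete_integral incr last_le k eP) //.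
rewrite discrete_integral_tail_deriv ?tail_deriv0 //.
- rewrite /P hornerZ horner_prod; congr (_ * _ * _).
  by apply: eq_bigr => l _; rewrite !hornerE.
- by rewrite ltnW //= ltnW.
- by rewrite dvdpZr ?dvdpp // invr_eq0 pnatr_eq0 -lt0n fact_gt0.
Qed.
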